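(* Let $\mathbb{F}$ be a field of characteristic not $2$, let $\mathcal{U}$ be a nonzero finite-dimensional $\mathbb{F}$-vector space with $\dim_{\mathbb{F}}\mathcal{U}=n$, let $b:\mathcal{U}\times\mathcal{U}\to\mathbb{F}$ be a nondegenerate symmetric bilinear form, and let $0\neq u\in\mathcal{U}$. Let $\mathcal{E}(\mathcal{U},b,u)=\mathbb{F}\times\mathcal{U}\times\mathbb{F}$ be the algebra with multiplication $$(\alpha,x,\beta)(\gamma,y,\delta)=(0,\,\alpha\gamma u,\,b(x,y))$$ for $x,y\in\mathcal{U}$, $\alpha,\beta,\gamma,\delta\in\mathbb{F}$. Then $\mathcal{E}(\mathcal{U},b,u)$ is a nilpotent evolution algebra of type $[1,n,1]$.
   Context: An evolution algebra (finite-dimensional here) is an algebra $\mathcal{E}$ over $\mathbb{F}$ with a basis $\{e_1,\ldots,e_m\}$ (a natural basis) such that $e_je_k=0$ for $j\neq k$. For an algebra $\mathcal{A}$, $\mathrm{ann}(\mathcal{A})=\{x\in\mathcal{A}: x\mathcal{A}=\mathcal{A}x=0\}$, $\mathrm{ann}^0(\mathcal{A})=0$, and $\mathrm{ann}^i(\mathcal{A})$ is defined by $\mathrm{ann}^i(\mathcal{A})/\mathrm{ann}^{i-1}(\mathcal{A})=\mathrm{ann}(\mathcal{A}/\mathrm{ann}^{i-1}(\mathcal{A}))$. With $\mathcal{A}^1=\mathcal{A}$ and $\mathcal{A}^{k+1}=\sum_{j=1}^k\mathcal{A}^j\mathcal{A}^{k+1-j}$, $\mathcal{A}$ is nilpotent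 if $\mathcal{A}^m=0$ for some $m$, equivalently $\mathrm{ann}^r(\mathcal{A})=\mathcal{A}$ for some $r$. The type of a finite-dimensional nilpotent algebra $\mathcal{A}$ is the sequence $[n_1,\ldots,n_r]$, where $r$ is the least natural number with $\mathrm{ann}^r(\mathcal{A})=\mathcal{A}$ and $n_i=\dim\mathrm{ann}^i(\mathcal{A})-\dim\mathrm{ann}^{i-1}(\mathcal{A})$. *)

(* Defs.v *)
From HB Require Import structures.
From mathcomp Require Import all_boot all_algebra.
Set Implicit Arguments.
Unset Strict Implicit.
Unset Printing Implicit Defensive.
Import GRing.Theory.
Local Open Scope ring_scope.

(* A finite-dimensional, not necessarily associative, algebra over F is a
   vectType A over F together with a bilinear product
   mul : {bilinear A -> A -> A}. *)

Section Annihilator.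
Variables (F : fieldType) (A : vectType F) (mul : {bilinear A -> A -> A}).

Definition lmul (x : A) : 'End(A) := linfun (mul x).
Definition rmul (x : A) : 'End(A) := linfun (applyr mul x).

Fact lmul_is_linear : linear lmul.
Proof.
by move=> a x y; apply/lfunP=> z; rewrite add_lfunE scale_lfunE !lfunE /= linearPl.
Qed.
HB.instance Definition _ := GRing.isSemilinear.Build F A 'End(A) _ lmul
  (GRing.semilinear_linear lmul_is_linear).

Fact rmul_is_linear : linear rmul.
Proof.
by move=> a x y; apply/lfunP=> z; rewrite add_lfunE scale_lfunE !lfunE /= linearPr.
Qed.
HB.instance Definition _ := GRing.isSemilinear.Build F A 'End(A) _ rmul
  (GRing.semilinear_linear rmul_is_linear).

Definition alg_ann : {vspace A} := (lker (linfun lmul) :&: lker (linfun rmul))%VS.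

Lemma memv_alg_ann x :
  reflect (forall y, mul x y = 0 /\ mul y x = 0) (x \in alg_ann).
Proof.
rewrite memv_cap !memv_ker !lfunE; apply: (iffP andP) => [[/eqP l /eqP r] y|xA].
  have := congr1 (fun f : 'End(A) => f y) l.
  by have := congr1 (fun f : 'End(A) => f y) r; rewrite !lfunE.
by split; apply/eqP/lfunP => y; rewrite !lfunE /=; case: (xA y).
Qed.

End Annihilator.

(* The quotient A / I is realised on the complement I^C of I, with canonical
   map the projection onto I^C along I. (vsproj I^C alone is not this map: it
   projects along (I^C)^C, which may differ from I.) *)
Section Quotient.
Variables (F : fieldType) (A : vectType F) (I : {vspace A}).

Definition quotv := subvs_of (I^C)%VS.

Definition quotv_pi : 'Hom(A, quotv) :=
  linfun (vsproj (I^C)%VS \o daddv_pi (I^C)%VS I).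

Let capCI : (I^C :&: I = 0)%VS. Proof. by rewrite capvC capv_compl. Qed.

Let val_pi x : vsval (quotv_pi x) = daddv_pi (I^C)%VS I x.
Proof. by rewrite lfunE /= vsprojK // memv_pi. Qed.

Lemma vsvalK_quotv : cancel vsval quotv_pi.
Proof.
by move=> x; apply: val_inj; rewrite /= val_pi daddv_pi_id // subvsP.
Qed.

Lemma memv_sub_quotv x : x - vsval (quotv_pi x) \in I.
Proof.
have xCI: x \in (I^C + I)%VS by rewrite addvC addv_complf memvf.
by rewrite val_pi -{1}(daddv_pi_add capCI xCI) addrC addKr memv_pi.
Qed.

Lemma lker_quotv_pi : lker quotv_pi = I.
Proof.
apply/vspaceP=> x; rewrite memv_ker; apply/eqP/idP => [x0|xI].
  by have := memv_sub_quotv x; rewrite x0 /= subr0.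
apply: val_inj; apply/eqP; rewrite /= -memv0 -capCI memv_cap.
by rewrite subvsP -[X in X \in I](subKr x) rpredB // memv_sub_quotv.
Qed.

Variable mul : {bilinear A -> A -> A}.

Definition quot_mul (x y : quotv) : quotv := quotv_pi (mul (vsval x) (vsval y)).

Fact quot_mul_is_bilinear : bilinear_for *:%R *:%R quot_mul.
Proof.
have vsP a x y: vsval (a *: x + y : quotv) = a *: vsval x + vsval y by [].
split=> z a x y; rewrite /quot_mul vsP.
  by rewrite linearPl linearP.
by rewrite linearPr linearP.
Qed.
HB.instance Definition _ :=
  bilinear_isBilinear.Build F quotv quotv quotv *:%R *:%R quot_mul
    quot_mul_is_bilinear.

Lemma quotv_piM :
    (forall x y, x \in I -> mul x y \in I /\ mul y x \in I) ->
  {morph quotv_pi : x y / mul x y >-> quot_mul x y}.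
Proof.
move=> idI x y; rewrite /quot_mul.
have xI := memv_sub_quotv x; have yI := memv_sub_quotv y.
set x' := vsval _ in xI *; set y' := vsval _ in yI *.
apply/eqP; rewrite -subr_eq0 -linearB -memv_ker lker_quotv_pi.
have -> : mul x y - mul x' y' = mul (x - x') y + mul x' (y - y').
  by rewrite linearBl linearBr addrA subrK.
by rewrite rpredD //; [case: (idI _ y xI) | case: (idI _ x' yI)].
Qed.

End Quotient.

Section Algebra.
Variables (F : fieldType) (A : vectType F) (mul : {bilinear A -> A -> A}).

(* ann^(i+1) is the full preimage in A of the annihilator of A / ann^i. The
   product of the quotient is defined for every subspace I; it is the induced
   one (quotv_piM) because each ann^i is an ideal (ann_series_ideal). *)
Fixpoint ann_series (i : nat) : {vspace A} :=
  if i is j.+1 then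
    (quotv_pi (ann_series j) @^-1: alg_ann (quot_mul (I := ann_series j) mul))%VS
  else 0%VS.

Fact memv_quotv_pi (I : {vspace A}) x : (quotv_pi I x == 0) = (x \in I).
Proof. by rewrite -memv_ker lker_quotv_pi. Qed.

Fact memv_ann_step (I : {vspace A}) x :
    (forall x y, x \in I -> mul x y \in I /\ mul y x \in I) ->
  reflect (forall y, mul x y \in I /\ mul y x \in I)
          (x \in (quotv_pi I @^-1: alg_ann (quot_mul (I := I) mul))%VS).
Proof.
move=> idI; rewrite -memv_preim; have piM := quotv_piM idI.
apply: (iffP (memv_alg_ann _ _)) => /= [annx y|annx y].
  by rewrite -!memv_quotv_pi !piM; case: (annx (quotv_pi I y)) => -> ->.
rewrite -[y]vsvalK_quotv -!piM.
by case: (annx (vsval y)); rewrite -!memv_quotv_pi => /eqP-> /eqP->.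
Qed.

Lemma ann_series_ideal i x y :
  x \in ann_series i -> mul x y \in ann_series i /\ mul y x \in ann_series i.
Proof.
elim: i x y => [|i idI] x y /=.
  by rewrite !memv0 => /eqP->; rewrite linear0l linear0r.
move/(memv_ann_step _ idI) => annx.
by split; apply/(memv_ann_step _ idI) => z; apply: idI; case: (annx y).
Qed.

Lemma memv_ann_seriesS i x :
  reflect (forall y, mul x y \in ann_series i /\ mul y x \in ann_series i)
          (x \in ann_series i.+1).
Proof. exact/memv_ann_step/ann_series_ideal. Qed.

Lemma ann_series1 : ann_series 1 = alg_ann mul.
Proof.
apply/vspaceP=> x; apply/memv_ann_seriesS/memv_alg_ann => annx y.
  by case: (annx y) => /=; rewrite !memv0 => /eqP-> /eqP->.
by case: (annx y) => -> ->; rewrite mem0v.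
Qed.

Lemma sub_ann_series i : (ann_series i <= ann_series i.+1)%VS.
Proof. by apply/subvP=> x xi; apply/memv_ann_seriesS=> y; apply: ann_series_ideal. Qed.

(* The span of all products x y with x in V and y in W, see mulv_subP. *)
Definition mulv (V W : {vspace A}) : {vspace A} :=
  <<[seq mul x y | x <- vbasis V, y <- vbasis W]>>%VS.

Lemma memv_mulv (V W : {vspace A}) x y :
  x \in V -> y \in W -> mul x y \in mulv V W.
Proof.
move=> xV yW; rewrite (coord_vbasis xV) (coord_vbasis yW).
rewrite linear_sumlz; apply: rpred_sum => i _.
rewrite linear_sumr; apply: rpred_sum => j _.
rewrite linearZl_LR linearZr_LR !rpredZ //; apply: memv_span.
by apply/allpairsP; exists ((vbasis V)`_i, (vbasis W)`_j); rewrite !mem_nth ?size_tuple.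
Qed.

Lemma mulv_subP (V W S : {vspace A}) :
  reflect {in V & W, forall x y, mul x y \in S} (mulv V W <= S)%VS.
Proof.
apply: (iffP idP) => [sS x y xV yW | mulS].
  exact/(subvP sS)/memv_mulv.
apply/span_subvP => _ /allpairsP[[x y] /= [xV yW ->]].
by apply: mulS; apply: vbasis_mem.
Qed.

(* power_seq k = [:: A^1; ...; A^k] *)
Fixpoint power_seq (k : nat) : seq {vspace A} :=
  if k is k'.+1 then
    let s := power_seq k' in
    rcons s (if k' is 0 then fullv
             else \sum_(i < k') mulv (nth 0%VS s i) (nth 0%VS s (k' - i.+1)))%VS
  else [::].

(* A^k for k > 0; the value at k = 0 is irrelevant. *)
Definition alg_power (k : nat) : {vspace A} := nth 0%VS (power_seq k) k.-1.

Lemma size_power_seq k : size (power_seq k) = k.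
Proof. by elim: k => //= k IHk; rewrite size_rcons IHk. Qed.

Lemma nth_power_seq k i : (i < k)%N -> nth 0%VS (power_seq k) i = alg_power i.+1.
Proof.
elim: k => //= k IHk; rewrite ltnS leq_eqVlt => /predU1P[-> //|ltik].
by rewrite nth_rcons size_power_seq ltik IHk.
Qed.

Lemma alg_power1 : alg_power 1 = fullv.
Proof. by []. Qed.

Lemma alg_powerS k : (0 < k)%N ->
  alg_power k.+1 = (\sum_(1 <= j < k.+1) mulv (alg_power j) (alg_power (k.+1 - j)))%VS.
Proof.
case: k => // k _; rewrite /alg_power [power_seq k.+2]/= -/(power_seq k.+1).
rewrite nth_rcons size_power_seq ltnn eqxx big_add1 big_mkord.
apply: eq_bigr => i _.
have lti : (k.+1 - i.+1 < k.+1)%N by rewrite ltnS subSS leq_subr.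
by rewrite (nth_power_seq (ltn_ord i)) (nth_power_seq lti) -subSn.
Qed.

Definition nilpotent_algebra : Prop :=
  exists2 m : nat, (0 < m)%N & alg_power m = 0%VS.

Definition evolution_algebra : Prop :=
  exists (m : nat) (e : m.-tuple A),
    basis_of fullv e /\ forall j k : 'I_m, j != k -> mul e`_j e`_k = 0.

(* s = [:: n_1; ...; n_r] is the type of A; the entry n_i of the mathematical
   notation is nth 0 s i.-1. *)
Definition has_type (s : seq nat) : Prop :=
  [/\ ann_series (size s) = fullv,
      forall i, ann_series i = fullv -> (size s <= i)%N
    & forall i, (i < size s)%N ->
        nth 0%N s i = (\dim (ann_series i.+1) - \dim (ann_series i))%N].

End Algebra.

Section EvolutionAlgebraOfForm.
Variables (F : fieldType) (U : vectType F) (b : {symmetric U}) (u : U).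

Local Notation evol_space := (F^o * U * F^o)%type.

Definition evol_mul (v w : evol_space) : evol_space :=
  let: (alpha, x, beta) := v in
  let: (gamma, y, delta) := w in
  (0, (alpha * gamma) *: u, b x y).

Fact evol_mul_is_bilinear : bilinear_for *:%R *:%R evol_mul.
Proof.
split=> [[[g y] d]|[[g y] d]] a [[a1 x1] b1] [[a2 x2] b2] /=.
  congr (_, _, _) => /=; first by rewrite scaler0 addr0.
    by rewrite scalerA -scalerDl mulrA -mulrDl.
  by rewrite linearPl.
congr (_, _, _) => /=; first by rewrite scaler0 addr0.
  by rewrite scalerA -scalerDl mulrCA -mulrDr.
by rewrite linearPr.
Qed.
HB.instance Definition _ :=
  bilinear_isBilinear.Build F evol_space evol_space evol_space *:%R *:%R evol_mul
    evol_mul_is_bilinear.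

End EvolutionAlgebraOfForm.

(* Main.v *)
(* The radical of the form is trivial and u is nonzero, so the annihilator
   series consists of the kernels of the projections F x U x F -> F x U -> F,
   which gives the type.  In characteristic not 2 the form b has an orthogonal
   basis x_1, ..., x_n, and (1, 0, 0), (0, x_i, 0), (0, 0, 1) is then a natural
   basis.  A^2 lies in ann^2, and both A^3 and A^4 lie in ann^1, so A^5 = 0;
   A^4 itself contains A^2 A^2, which does not vanish if b(u, u) != 0. *)
From HB Require Import structures.
Require Import Defs.
From mathcomp Require Import all_boot all_algebra.
Import GRing.Theory.
Local Open Scope ring_scope.

(** Rank-nullity, for computing dimensions of annihilators that are kernels of coordinate
    projections. *)
Lemma dim_lker_surj (F : fieldType) (V W : vectType F) (f : 'Hom(V, W)) :
  (forall w, exists v, f v = w) ->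
  (\dim (lker f) + \dim {:W})%N = \dim {:V}.
Proof.
move=> fsurj; rewrite -(limg_ker_dim f {:V}) capfv; congr (_ + \dim _)%N.
apply/esym/vspaceP => w; rewrite memvf; have [v <-] := fsurj w.
exact/memv_img/memvf.
Qed.

Section OrthogonalBasis.
Context {F : fieldType} {U : vectType F} (b : {symmetric U}).
Hypothesis charF : 2%N \notin [pchar F].

Lemma symmetric_formC x y : b x y = b y x.
Proof. by rewrite hermC /= expr0 mul1r. Qed.

(** Polarization: if $b(z,z)=0$ for all basis vectors and all their pairwise sums, then $2b(x,y)=0$
    on the basis, and 2 is invertible. *)
Lemma exists_anisotropic (V : {vspace U}) :
  {in V &, forall x y, b x y = 0} \/ exists2 v, v \in V & b v v != 0.
Proof.
have two_neq0 : 2%:R != 0 :> F.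
  by apply: contraNneq charF => two0; rewrite inE /= two0 eqxx.
(* Testing a finite list makes the alternative a boolean. The extra 0 puts the basis vectors
   themselves among the sums. *)
have [/allP iso|/allPn[v vX bvv]] :=
  boolP (all (fun v => b v v == 0)
    [seq x + y | x <- 0 :: vbasis V, y <- vbasis V]); last first.
  right; exists v => //; move/allpairsP: vX => [[x y] /= [xX yX ->]].
  rewrite rpredD ?(vbasis_mem yX) //; move: xX; rewrite inE.
  by case/predU1P => [->|/vbasis_mem //]; rewrite mem0v.
left; suff b0 : {in vbasis V &, forall x y, b x y = 0}.
  move=> x y xV yV; rewrite (coord_vbasis xV) (coord_vbasis yV).
  rewrite linear_sumlz big1 // => i _; rewrite linear_sumr big1 // => j _.
  by rewrite linearZl_LR linearZr_LR /= b0 ?mulr0 ?scaler0 // mem_nth ?size_tuple.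
have diag0 x : x \in vbasis V -> b x x = 0.
  move=> xX; apply/eqP/iso; apply/allpairsP; exists (0, x).
  by rewrite /= add0r inE eqxx.
move=> x y xX yX; have : b (x + y) (x + y) == 0.
  by apply: iso; apply/allpairsP; exists (x, y); rewrite /= inE xX orbT.
rewrite linearDl !linearDr /= !diag0 // add0r addr0 (symmetric_formC y x).
by rewrite -mulr2n -mulr_natl mulf_eq0 (negPf two_neq0) => /eqP.
Qed.

(** Induction on $\dim V$: either $b$ vanishes on $V$ and any basis works, or an anisotropic $v$
    splits off, $V = \langle v\rangle \oplus (V \cap v^\perp)$. *)
Lemma exists_orthogonal_basis (V : {vspace U}) :
  exists2 X : seq U, basis_of V X & {in X &, forall x y, x != y -> b x y = 0}.
Proof.
have [m] := ubnP (\dim V); elim: m V => // m IHm V dimV.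
have [b0|[v vV bvv]] := exists_anisotropic V.
  exists (vbasis V); first exact: vbasisP.
  by move=> x y /vbasis_mem xV /vbasis_mem yV _; apply: b0.
have vNorth : v \notin orthov b V by apply/mem_orthovPn; exists v.
have vV0 : (<[v]> :&: (V :&: orthov b <[v]>))%VS = 0%VS.
  apply/eqP; rewrite -subv0; apply/subvP=> x.
  rewrite !memv_cap => /and3P[/vlineP[k ->] _].
  rewrite mem_orthov1 linearZl_LR /= mulf_eq0 (negPf bvv) orbF => /eqP->.
  by rewrite scale0r mem0v.
have v0 : v != 0 by apply: contraNneq bvv => ->; rewrite linear0l.
have dimV_gt0 : (0 < \dim V)%N.
  by rewrite lt0n dimv_eq0; apply: contraTneq vV => ->; rewrite memv0.
(* Cutting $V$ with $v^\perp$ lowers the dimension by exactly one. *)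
have dimW := eq_dim_orthov1 vNorth.
have [|X basX orthX] := IHm (V :&: orthov b <[v]>)%VS.
  by rewrite -dimW prednK.
have memX x : x \in X -> b x v = 0.
  by move/(basis_mem basX); rewrite memv_cap mem_orthov1 => /andP[_ /eqP].
exists (v :: X).
  rewrite basisEdim -cat1s span_cat span_seq1 (span_basis basX) size_cat /=.
  have sWV : (<[v]> + V :&: orthov b <[v]> <= V)%VS.
    by rewrite subv_add -memvE vV capvSl.
  have dimS : \dim (<[v]> + V :&: orthov b <[v]>) = \dim V.
    by rewrite dimv_disjoint_sum // -dimW dim_vline v0 add1n prednK.
  have /eqP-> : (<[v]> + V :&: orthov b <[v]> == V)%VS.
    by rewrite eqEdim sWV dimS /=.
  by rewrite subvv -(size_basis (X := in_tuple X) basX) -dimW add1n prednK /=.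
move=> x y; rewrite !inE => /predU1P[->|xX] /predU1P[->|yX]; rewrite ?eqxx //.
- by rewrite symmetric_formC memX.
- by rewrite memX.
exact: orthX.
Qed.

End OrthogonalBasis.

Lemma alg_powerS_subP (F : fieldType) (A : vectType F)
    (mul : {bilinear A -> A -> A}) k (S : {vspace A}) : (0 < k)%N ->
  (forall j x y, (0 < j <= k)%N -> x \in alg_power mul j ->
     y \in alg_power mul (k.+1 - j) -> mul x y \in S) ->
  (alg_power mul k.+1 <= S)%VS.
Proof.
move=> k0 mulS; rewrite alg_powerS // big_add1 big_mkord.
by apply/subv_sumP => i _; apply/mulv_subP => x y; apply: mulS => /=.
Qed.

Section EvolOfForm.
Context {F : fieldType} {U : vectType F} (b : {symmetric U}) (u : U).
Hypotheses (b_nondeg : nondegenerate b) (u_neq0 : u != 0).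

Local Notation E := (Vector.clone F (F^o * U * F^o)%type _).
Definition evol_bilinear : {bilinear E -> E -> E} := evol_mul b u.
Local Notation mul := evol_bilinear.
Local Notation ann := (ann_series mul).

Lemma nondegenerate_eq0 x : (forall y, b x y = 0) -> x = 0.
Proof.
move=> bx0; apply/eqP; rewrite -memv0 -(eqP b_nondeg).
by apply/mem_orthovP => y _.
Qed.

(** Multiplying $(\alpha,x,\beta)$ by $(1,0,0)$ detects $\alpha u$, hence $\alpha$; multiplying by
    all $(0,y,0)$ detects $x$ by nondegeneracy. *)
Lemma memv_ann1 (v : E) : (v \in ann 1) = (v.1 == 0).
Proof.
case: v => [[a x] c]; apply/memv_ann_seriesS/eqP => /= [annv|[-> ->] [[g y] d]].
  congr (_, _).
    have [] := annv (1, 0, 0); rewrite memv0 /= => /eqP[/eqP].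
    by rewrite mulr1 scaler_eq0 (negPf u_neq0) orbF => /eqP.
  apply: nondegenerate_eq0 => y; have [] := annv (0, y, 0).
  by rewrite memv0 /= => /eqP[].
by rewrite !memv0 /= mul0r mulr0 scale0r linear0l linear0r.
Qed.

(** A product lies in $\mathrm{ann}^1$ exactly when its middle coordinate $\alpha\gamma u$ vanishes;
    the factor $(1,0,0)$ already tests this. *)
Lemma memv_ann2 (v : E) : (v \in ann 2) = (v.1.1 == 0).
Proof.
case: v => [[a x] c].
apply/memv_ann_seriesS/eqP => [annv|/= -> [[g y] d]].
  have [] := annv (1, 0, 0); rewrite memv_ann1 /= => /eqP[/eqP].
  by rewrite mulr1 scaler_eq0 (negPf u_neq0) orbF => /eqP.
by rewrite !memv_ann1 /= mul0r mulr0 scale0r.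
Qed.

(** Every product has first coordinate 0, so it lies in $\mathrm{ann}^2$. *)
Lemma ann3 : ann 3 = fullv.
Proof.
apply/vspaceP => -[[a x] c]; rewrite memvf; apply/memv_ann_seriesS.
by move=> [[g y] d]; rewrite !memv_ann2 /=.
Qed.

Lemma dim_regular : \dim {:F^o} = 1%N.
Proof. by rewrite dimvf. Qed.

Lemma dim_evol : \dim {:E} = (\dim {:U}).+2.
Proof. by rewrite !dimvf /dim /= addn1. Qed.

Lemma dim_ann1 : \dim (ann 1) = 1%N.
Proof.
have -> : ann 1 = lker (linfun (fst : E -> F^o * U)).
  by apply/vspaceP => v; rewrite memv_ann1 memv_ker lfunE.
have := @dim_lker_surj _ _ _ (linfun (fst : E -> F^o * U))
  (fun w => ex_intro _ (w, 0) (lfunE _ _)).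
have -> : \dim {:(F^o * U)%type} = (\dim {:U}).+1 by rewrite !dimvf.
by rewrite dim_evol -[RHS]add1n => /addIn.
Qed.

Lemma dim_ann2 : \dim (ann 2) = (\dim {:U}).+1.
Proof.
pose p : {linear E -> F^o} := fst \o fst.
have -> : ann 2 = lker (linfun p).
  by apply/vspaceP => v; rewrite memv_ann2 memv_ker lfunE.
have := @dim_lker_surj _ _ _ (linfun p)
  (fun w => ex_intro _ (w, 0, 0) (lfunE _ _)).
by rewrite dim_evol dim_regular addn1 => -[].
Qed.

Lemma nilpotent_evol : nilpotent_algebra mul.
Proof.
have A2 : (alg_power mul 2 <= ann 2)%VS.
  apply: alg_powerS_subP => // j [[a x] c] [[g y] d] _ _ _.
  by rewrite memv_ann2 /=.
have ann2_mul x : x \in ann 2 -> forall y, mul x y \in ann 1 /\ mul y x \in ann 1.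
  exact: (elimT (memv_ann_seriesS mul 1 x)).
have A3 : (alg_power mul 3 <= ann 1)%VS.
  apply: alg_powerS_subP => // -[|[|[|]]] // x y _ xA yA.
    by have /ann2_mul /(_ x)[] := subvP A2 _ yA.
  by have /ann2_mul /(_ y)[] := subvP A2 _ xA.
have A4 : (alg_power mul 4 <= ann 1)%VS.
  (* The exponents are 1+3, 2+2 or 3+1, so some factor lies in $\mathrm{ann}^2$, which multiplies
     into $\mathrm{ann}^1$. *)
  apply: alg_powerS_subP => // -[|[|[|[|]]]] // x y _ xA yA.
  - by have /(subvP (sub_ann_series mul 1)) /ann2_mul /(_ x)[] := subvP A3 _ yA.
  - by have /ann2_mul /(_ y)[] := subvP A2 _ xA.
  by have /(subvP (sub_ann_series mul 1)) /ann2_mul /(_ y)[] := subvP A3 _ xA.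
exists 5%N => //; apply/eqP; rewrite -subv0.
have ann1_mul x : x \in ann 1 -> forall y, mul x y \in 0%VS /\ mul y x \in 0%VS.
  exact: (elimT (memv_ann_seriesS mul 0 x)).
(* One of two positive exponents with sum 5 is at least 3, so one factor lies in $\mathrm{ann}^1$
   and the product is 0. *)
apply: alg_powerS_subP => // -[|[|[|[|[|]]]]] // x y _ xA yA.
- by have /ann1_mul /(_ x)[] := subvP A4 _ yA.
- by have /ann1_mul /(_ x)[] := subvP A3 _ yA.
- by have /ann1_mul /(_ y)[] := subvP A3 _ xA.
by have /ann1_mul /(_ y)[] := subvP A4 _ xA.
Qed.

Lemma has_type_evol : has_type mul [:: 1%N; \dim {:U}; 1%N].
Proof.
split => [|i|]; first exact: ann3.
  move=> anni; rewrite ltnNge; apply/negP => lei2.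
  (* Minimality of the length 3: the series increases, and $(1,0,0)$ is not in $\mathrm{ann}^2$. *)
  have subi2 : (ann i <= ann 2)%VS.
    case: i {anni} lei2 => [|[|[|]]] // _; last exact: (sub_ann_series mul 1).
    exact: sub0v.
  have : (1, 0, 0) \in ann 2 by rewrite (subvP subi2) // anni memvf.
  by rewrite memv_ann2 oner_eq0.
case=> [|[|[|]]] // _.
- by rewrite [nth _ _ _]/= dim_ann1 dimv0.
- by rewrite [nth _ _ _]/= dim_ann1 dim_ann2 subn1.
by rewrite [nth _ _ _]/= ann3 dim_evol dim_ann2 subSnn.
Qed.

Lemma evolution_evol : 2%N \notin [pchar F] -> evolution_algebra mul.
Proof.
move=> charF; have [X basX orthX] := exists_orthogonal_basis b charF {:U}.
have inj_lin : linear (fun x : U => (0, x, 0) : E).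
  by move=> k x y; congr (_, _, _) => /=; rewrite scaler0 addr0.
pose inU : {linear U -> E} :=
  HB.pack (fun x : U => (0, x, 0) : E) (GRing.isLinear.Build F U E _ _ inj_lin).
pose e0 : E := (1, 0, 0); pose e1 : E := (0, 0, 1).
pose e := e0 :: e1 :: map (linfun inU) X.
have basE : basis_of fullv e.
  (* The list has $n+2 = \dim E$ entries, so spanning suffices. *)
  rewrite basisEdim /= size_map dim_evol.
  rewrite -(size_basis (X := in_tuple X) basX) leqnn andbT.
  rewrite !span_cons -limg_span (span_basis basX).
  apply/subvP => -[[a x] c] _.
  have -> : (a, x, c) = a *: e0 + (c *: e1 + linfun inU x) :> E.
    have scaler1 k : k *: (1 : F^o) = k by exact: mulr1.
    by rewrite lfunE; congr (_, _, _); rewrite /= ?scaler1 ?scaler0 ?add0r ?addr0.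
  by rewrite !memv_add ?memvZ ?memv_line ?memv_img ?memvf.
have orthE : {in e &, forall v w, v != w -> mul v w = 0}.
  move=> v w; rewrite !inE.
  (* Products of distinct vectors involving [e0] or [e1] vanish coordinatewise; only
     $(0,x,0)(0,y,0)=(0,0,b(x,y))$ needs the orthogonality of [X]. *)
  case/or3P => [/eqP->|/eqP->|/mapP[x xX ->]];
    case/or3P => [/eqP->|/eqP->|/mapP[y yX ->]]; rewrite ?eqxx ?lfunE //= => vw;
    rewrite ?mul0r ?mulr0 ?scale0r ?linear0l ?linear0r //.
  by rewrite orthX //; apply: contraNneq vw => ->.
exists (size e), (in_tuple e); split=> // j k neq_jk.
apply: orthE; rewrite ?mem_nth //.
(* A basis has no repetitions, so distinct indices give distinct vectors. *)
by rewrite nth_uniq // (free_uniq (basis_free basE)).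
Qed.

End EvolOfForm.

Theorem proposition4p10 (F : fieldType) (U : vectType F) (n : nat)
    (b : {symmetric U}) (u : U)
    (charF : 2%N \notin [pchar F])
    (dimU : \dim {:U} = n) (U_neq0 : {:U}%VS != 0%VS)
    (b_nondeg : nondegenerate b) (u_neq0 : u != 0) :
  [/\ nilpotent_algebra (evol_mul b u),
      evolution_algebra (evol_mul b u)
    & has_type (evol_mul b u) [:: 1%N; n; 1%N]].
Proof.
split; [exact: nilpotent_evol | exact: evolution_evol |].
by rewrite -dimU; apply: has_type_evol.
Qed.
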